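(* Let $\mathcal{A}$ and $\mathcal{B}$ be structures that are positive enumerably bi-transformable. Then $eSp(\mathcal{A})=eSp(\mathcal{B})$.
   Context: Structures: all structures are countable with universe $\omega$, in a relational language $(R_i)_{i\in\omega}$ where $R_i$ has arity $a_i$ and $i\mapsto a_i$ is computable. The languages of $\mathcal{A}$ and $\mathcal{B}$ may differ. A class of structures (in a fixed language) is viewed as a category whose morphisms are the isomorphisms between its members; $Hom(\mathcal{A},\mathcal{B})$ is the set of isomorphisms from $\mathcal{A}$ to $\mathcal{B}$. $Iso(\mathcal{A})=\{\mathcal{C}:\mathcal{C}\cong\mathcal{A}\}$ (structures with universe $\omega$); a functor $F:\mathcal{A}\to\mathcal{B}$ means a functor $F:Iso(\mathcal{A})\to Iso(\mathcal{B})$. A functor maps structures to structures and isomorphisms $f:\mathcal{C}\to\mathcal{D}$ to isomorphisms $F(f):F(\mathcal{C})\to F(\mathcal{D})$, preserving composition and identities. Coding: tuples of natural numbers are coded by numbers via a fixed computable coding $\langle\cdot\rangle$, and $\oplus$ and $\bigoplus_{i\in\omega}$ denote the usual effective joins of sets. $Graph(f)=\{\langle x,y\rangle: f(x)=y\}$. An enumeration operator $\Psi$ is a c.e. set of pairs $(E,x)$ with $E$ (a code of) a finite set, and $\Psi^X=\{x:\exists E\subseteq X\ (E,x)\in\Psi\}$; $d_e(X)$ is the enumeration degree of $X$. The positive diagram of $\mathcal{A}$ is $P(\mathcal{A})= {=}\oplus{\neq}\oplus\bigoplus_{i\in\omega}R_i^{\mathcal{A}}$, where $=$ and $\neq$ are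 equality and inequality on $\omega$. For an enumeration $f$ of $\omega$ (a surjection $f:\omega\to\omega$) and $X\subseteq\omega^n$ let $f^{-1}(X)=\{\langle x_1,\dots,x_n\rangle:(f(x_1),\dots,f(x_n))\in X\}$, and let $f^{-1}(\mathcal{A})=f^{-1}(=)\oplus f^{-1}(\neq)\oplus f^{-1}(R_0^{\mathcal{A}})\oplus f^{-1}(R_1^{\mathcal{A}})\oplus\cdots$. The enumeration degree spectrum of $\mathcal{A}$ is $eSp(\mathcal{A})=\{d_e(f^{-1}(\mathcal{A})): f\text{ is an enumeration of }\omega\}$. A functor $F:\mathfrak{C}\to\mathfrak{D}$ is positive enumerable if there are enumeration operators $\Psi,\Psi_*$ such that for all $\mathcal{C}_1,\mathcal{C}_2\in\mathfrak{C}$: (1) $\Psi^{P(\mathcal{C}_1)}=P(F(\mathcal{C}_1))$; (2) for all $f\in Hom(\mathcal{C}_1,\mathcal{C}_2)$, $\Psi_*^{P(\mathcal{C}_1)\oplus Graph(f)\oplus P(\mathcal{C}_2)}=Graph(F(f))$. A functor $F:\mathfrak{C}\to\mathfrak{D}$ is enumeration isomorphic to $G:\mathfrak{C}\to\mathfrak{D}$ via an enumeration operator $\Lambda$ if for every $\mathcal{C}\in\mathfrak{C}$, $\Lambda^{P(\mathcal{C})}$ is (the graph of) an isomorphism $F(\mathcal{C})\to G(\mathcal{C})$ and for every $h\in Hom(\mathcal{C}_1,\mathcal{C}_2)$ in $\mathfrak{C}$, $\Lambda^{P(\mathcal{C}_2)}\circ F(h)=G(h)\circ\Lambda^{P(\mathcal{C}_1)}$.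 Functors $F:\mathfrak{C}\to\mathfrak{D}$ and $G:\mathfrak{D}\to\mathfrak{C}$ are enumeration pseudo inverses if there are enumeration operators $\Lambda_{\mathfrak{C}},\Lambda_{\mathfrak{D}}$ such that $Id_{\mathfrak{C}}$ is enumeration isomorphic to $G\circ F$ via $\Lambda_{\mathfrak{C}}$ (so $\Lambda_{\mathfrak{C}}^{P(\mathcal{C})}:\mathcal{C}\to G(F(\mathcal{C}))$), $Id_{\mathfrak{D}}$ is enumeration isomorphic to $F\circ G$ via $\Lambda_{\mathfrak{D}}$, and for all $\mathcal{C}\in\mathfrak{C}$, $\mathcal{E}\in\mathfrak{D}$: $\Lambda_{\mathfrak{D}}^{P(F(\mathcal{C}))}=F(\Lambda_{\mathfrak{C}}^{P(\mathcal{C})}):F(\mathcal{C})\to F(G(F(\mathcal{C})))$ and $\Lambda_{\mathfrak{C}}^{P(G(\mathcal{E}))}=G(\Lambda_{\mathfrak{D}}^{P(\mathcal{E})}):G(\mathcal{E})\to G(F(G(\mathcal{E})))$. Structures $\mathcal{A}$ and $\mathcal{B}$ are positive enumerably bi-transformable if there are positive enumerable functors $F:\mathcal{A}\to\mathcal{B}$ and $G:\mathcal{B}\to\mathcal{A}$ that are enumeration pseudo inverses. *)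

(* Defs.v *)
From mathcomp Require Import all_boot.
From mathcomp Require Import all_classical.

Set Implicit Arguments.
Unset Strict Implicit.
Unset Printing Implicit Defensive.

Local Open Scope classical_set_scope.

(** A partial function from k-tuples of natural numbers to natural numbers is
    represented by its graph [phi : k.-tuple nat -> set nat], where [phi v y]
    means that [phi v] is defined with value [y]. *)

Definition compose_pfun k m (phi : m.-tuple nat -> set nat)
    (psi : 'I_m -> k.-tuple nat -> set nat) (v : k.-tuple nat) : set nat :=
  [set y | exists2 w : m.-tuple nat,
     (forall i, psi i v (tnth w i)) & phi w y].

Fixpoint primrec_pfun k (phi : k.-tuple nat -> set nat)
    (psi : k.+2.-tuple nat -> set nat) (v : k.-tuple nat) (n : nat) : set nat :=
  match n with
  | 0 => phi v
  | p.+1 => [set y | exists2 r, primrec_pfun phi psi v p r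
                              & psi [tuple of p :: r :: v] y]
  end.

Definition minimize_pfun k (phi : k.+1.-tuple nat -> set nat)
    (v : k.-tuple nat) : set nat :=
  [set y | phi [tuple of y :: v] 0 /\
           forall z, z < y -> exists r, phi [tuple of z :: v] r.+1].

(** Kleene's partial recursive functions. *)
Inductive partial_recursive : forall k, (k.-tuple nat -> set nat) -> Prop :=
| partrec_zero :
    partial_recursive (fun _ : 0.-tuple nat => [set 0])
| partrec_succ :
    partial_recursive (fun v : 1.-tuple nat => [set (thead v).+1])
| partrec_proj k (i : 'I_k) :
    partial_recursive (fun v : k.-tuple nat => [set tnth v i])
| partrec_comp k m (phi : m.-tuple nat -> set nat)
    (psi : 'I_m -> k.-tuple nat -> set nat) :
    partial_recursive phi -> (forall i, partial_recursive (psi i)) ->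
    partial_recursive (compose_pfun phi psi)
| partrec_rec k (phi : k.-tuple nat -> set nat)
    (psi : k.+2.-tuple nat -> set nat) :
    partial_recursive phi -> partial_recursive psi ->
    partial_recursive (fun v : k.+1.-tuple nat =>
      primrec_pfun phi psi [tuple of behead v] (thead v))
| partrec_min k (phi : k.+1.-tuple nat -> set nat) :
    partial_recursive phi -> partial_recursive (minimize_pfun phi).

Definition computable (a : nat -> nat) : Prop :=
  partial_recursive (fun v : 1.-tuple nat => [set a (thead v)]).

Definition ce (W : set nat) : Prop :=
  exists2 phi : 1.-tuple nat -> set nat, partial_recursive phi &
    W = [set x | exists y, phi [tuple x] y].

(** Tuples of every length are coded by the bijection
    [CodeSeq.code : seq nat -> nat]. *)
Definition pair_code (x y : nat) : nat := CodeSeq.code [:: x; y].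

Definition tuple_codes n (X : set (n.-tuple nat)) : set nat :=
  [set CodeSeq.code t | t in X].

Definition join (X Y : set nat) : set nat :=
  [set x.*2 | x in X] `|` [set y.*2.+1 | y in Y].

Definition bigjoin (X : nat -> set nat) : set nat :=
  [set z | exists i x, X i x /\ z = pair_code i x].

Definition graph (f : nat -> nat) : set nat :=
  [set z | exists x y, f x = y /\ z = pair_code x y].

(** An enumeration operator is a c.e. set [Psi] of coded pairs; in the pair
    with code [pair_code (CodeSeq.code E) x], the list [E] stands for the finite
    set of its members. *)
Definition enum_app (Psi X : set nat) : set nat :=
  [set x | exists E : seq nat,
     [set` E] `<=` X /\ Psi (pair_code (CodeSeq.code E) x)].

Definition enum_reducible (Y X : set nat) : Prop :=
  exists2 Psi, ce Psi & Y = enum_app Psi X.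

Definition enum_degree (X : set nat) : set (set nat) :=
  [set Y | enum_reducible Y X /\ enum_reducible X Y].

Record language := Language {
  arity : nat -> nat;
  arity_computable : computable arity
}.

(** Structures with universe [nat]. *)
Definition structure (L : language) : Type :=
  forall i, set ((arity L i).-tuple nat).

Definition eq_rel : set (2.-tuple nat) :=
  [set t | tnth t ord0 = tnth t ord_max].

Definition neq_rel : set (2.-tuple nat) :=
  [set t | tnth t ord0 <> tnth t ord_max].

Definition pos_diagram L (A : structure L) : set nat :=
  join (join (tuple_codes eq_rel) (tuple_codes neq_rel))
       (bigjoin (fun i => tuple_codes (A i))).

Definition pullback_rel (f : nat -> nat) n (X : set (n.-tuple nat)) : set nat :=
  tuple_codes [set t : n.-tuple nat | X (map_tuple f t)].

Definition pullback L (f : nat -> nat) (A : structure L) : set nat :=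
  join (join (pullback_rel f eq_rel) (pullback_rel f neq_rel))
       (bigjoin (fun i => pullback_rel f (A i))).

Definition enumeration (f : nat -> nat) : Prop := forall y, exists x, f x = y.

Definition eSp L (A : structure L) : set (set (set nat)) :=
  [set enum_degree (pullback f A) | f in enumeration].

Definition Hom L (A B : structure L) : set (nat -> nat) :=
  [set f | bijective f /\ forall i t, A i t <-> B i (map_tuple f t)].

Definition Iso L (A : structure L) : set (structure L) :=
  [set C | exists f, Hom C A f].

Lemma Hom_id L (A : structure L) : Hom A A id.
Proof.
split=> [|i t]; first by exists id.
suff -> : map_tuple id t = t by [].
by apply: val_inj; rewrite /= map_id.
Qed.

Lemma Hom_comp L (A B C : structure L) f g :
  Hom A B f -> Hom B C g -> Hom A C (g \o f).
Proof.
move=> [bf hf] [bg hg]; split=> [|i t]; first exact: bij_comp.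
suff -> : map_tuple (g \o f) t = map_tuple g (map_tuple f t).
  by rewrite hf hg.
by apply: val_inj; rewrite /= map_comp.
Qed.

(** Functors between classes of structures, with isomorphisms as morphisms.
    Only the values of [fobj] on members of [K], and of [fmor X Y] on [Hom X Y]
    for [X], [Y] in [K], are meaningful: all axioms below and all later
    conditions on functors are restricted to these. *)
Record functor L L' (K : set (structure L)) (K' : set (structure L')) :=
  Functor {
    fobj : structure L -> structure L';
    fmor : structure L -> structure L -> (nat -> nat) -> (nat -> nat);
    fobj_in : forall X, K X -> K' (fobj X);
    fmor_in : forall X Y h, K X -> K Y -> Hom X Y h ->
      Hom (fobj X) (fobj Y) (fmor X Y h);
    fmor_id : forall X, K X -> fmor X X id = id;
    fmor_comp : forall X Y Z h k, K X -> K Y -> K Z ->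
      Hom X Y h -> Hom Y Z k ->
      fmor X Z (k \o h) = fmor Y Z k \o fmor X Y h
  }.

Definition functor_id L (K : set (structure L)) : functor K K :=
  @Functor L L K K id (fun _ _ h => h) (fun _ KX => KX)
    (fun _ _ _ _ _ Hh => Hh) (fun _ _ => erefl)
    (fun _ _ _ _ _ _ _ _ _ _ => erefl).

Section FunctorComposition.
Context L1 L2 L3 (K1 : set (structure L1)) (K2 : set (structure L2))
  (K3 : set (structure L3)) (G : functor K2 K3) (F : functor K1 K2).

Let cobj X := fobj G (fobj F X).
Let cmor X Y h := fmor G (fobj F X) (fobj F Y) (fmor F X Y h).

Fact functor_comp_in X : K1 X -> K3 (cobj X).
Proof. by move=> KX; do 2!apply: fobj_in. Qed.

Fact functor_comp_mor X Y h : K1 X -> K1 Y -> Hom X Y h ->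
  Hom (cobj X) (cobj Y) (cmor X Y h).
Proof. by move=> KX KY Hh; do 2!(apply: fmor_in => //; try exact: fobj_in). Qed.

Fact functor_comp_id X : K1 X -> cmor X X id = id.
Proof. by move=> KX; rewrite /cmor !fmor_id//; exact: fobj_in. Qed.

Fact functor_comp_comp X Y Z h k : K1 X -> K1 Y -> K1 Z ->
  Hom X Y h -> Hom Y Z k -> cmor X Z (k \o h) = cmor Y Z k \o cmor X Y h.
Proof.
move=> KX KY KZ Hh Hk; rewrite /cmor (@fmor_comp _ _ _ _ F X Y Z)//.
by apply: fmor_comp; [exact: fobj_in..|exact: fmor_in|exact: fmor_in].
Qed.

Definition functor_comp : functor K1 K3 :=
  Functor functor_comp_in functor_comp_mor functor_comp_id functor_comp_comp.
End FunctorComposition.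

Definition positive_enumerable L L' (K : set (structure L))
    (K' : set (structure L')) (F : functor K K') : Prop :=
  exists Psi PsiS : set nat, [/\ ce Psi, ce PsiS &
    forall C1 C2, K C1 -> K C2 ->
      enum_app Psi (pos_diagram C1) = pos_diagram (fobj F C1) /\
      forall f, Hom C1 C2 f ->
        enum_app PsiS (join (join (pos_diagram C1) (graph f)) (pos_diagram C2))
        = graph (fmor F C1 C2 f)].

(** As [graph] is injective, the function whose graph is
    [enum_app Lam (pos_diagram C)] is unique; below it is named by universally
    quantifying over the functions with that graph. *)
Definition enum_isomorphic_via L L' (K : set (structure L))
    (K' : set (structure L')) (Lam : set nat) (F G : functor K K') : Prop :=
  (forall C, K C -> exists2 u, Hom (fobj F C) (fobj G C) u &
     enum_app Lam (pos_diagram C) = graph u) /\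
  (forall C1 C2 h u1 u2, K C1 -> K C2 -> Hom C1 C2 h ->
     enum_app Lam (pos_diagram C1) = graph u1 ->
     enum_app Lam (pos_diagram C2) = graph u2 ->
     u2 \o fmor F C1 C2 h = fmor G C1 C2 h \o u1).

Definition enum_pseudo_inverses L L' (K : set (structure L))
    (K' : set (structure L')) (F : functor K K') (G : functor K' K) : Prop :=
  exists Lam Lam' : set nat, [/\ ce Lam, ce Lam',
    enum_isomorphic_via Lam (functor_id K) (functor_comp G F),
    enum_isomorphic_via Lam' (functor_id K') (functor_comp F G) &
    (forall C u, K C -> enum_app Lam (pos_diagram C) = graph u ->
       enum_app Lam' (pos_diagram (fobj F C)) =
       graph (fmor F C (fobj G (fobj F C)) u)) /\
    (forall E u, K' E -> enum_app Lam' (pos_diagram E) = graph u ->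
       enum_app Lam (pos_diagram (fobj G E)) =
       graph (fmor G E (fobj F (fobj G E)) u))].

Definition bi_transformable LA LB (A : structure LA) (B : structure LB) : Prop :=
  exists (F : functor (Iso A) (Iso B)) (G : functor (Iso B) (Iso A)),
    [/\ positive_enumerable F, positive_enumerable G & enum_pseudo_inverses F G].

(* Main.v *)
From mathcomp Require Import all_boot.
From mathcomp Require Import all_classical.
Require Import Defs.

Set Implicit Arguments.
Unset Strict Implicit.
Unset Printing Implicit Defensive.

Local Open Scope classical_set_scope.

(** An enumeration pullback of a structure carries the same information as an
    isomorphic copy of the structure together with the graph of a function,
    and the two functors trade copies of [A] for copies of [B] at the cost of a
    graph only.  Write [<=] for enumeration reducibility, [P] for the positive
    diagram and [+] for the join.

    For an enumeration [f], the relations [f x = f y] and [f x <> f y] are both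
    enumerated by [pullback f A], so the least representatives of the fibres of
    [f] can be listed from it, [h n] being the [n]-th one.  Renaming along [h]
    gives a copy [C] of [A], and with [k x] the index of the fibre of [x] one
    has [f = f \o h \o k]; hence [pullback f A] is equivalent to
    [P C + graph k] ([pullback_canonical]).  Conversely, for any copy [D] of
    [B] and any [t : nat -> nat], the set [P D + graph t] is equivalent to a
    pullback of [B]: enumerate [D] by sending [n.*2] to [n] and [n.*2.+1] to
    [t n] ([pullback_absorb]).  Then [D] is seen on the even numbers, and [t]
    is recovered from the pulled back equality.

    Let [C] and [k] come from [f], and let [u : C -> G (F C)] be the
    isomorphism enumerated from [P C].  Then [P (F C) <= P C] and
    [graph u <= P C], while [P C <= P (G (F C)) + graph u] because a diagram
    can be pulled back along an isomorphism, and [P (G (F C)) <= P (F C)].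
    So [P C + graph k] is equivalent to [P (F C) + graph u + graph k], which is
    of the form [P D + graph t] with [D := F C] and [t] interleaving [u] and
    [k].  This gives one inclusion ([eSp_subset]), and the other by exchanging
    the roles of [A] and [B].

    All reductions are obtained from one criterion ([enum_reducible_by]): if
    membership in [Y] is expressed from membership in [X], recursive conditions
    and c.e. conditions by conjunction, disjunction, number quantifiers
    [exists] and bounded [forall], then [Y <= X].  To prove it, such a
    condition is approximated by recursive conditions in which every [exists]
    is bounded by a common number and [X] is replaced by a finite set; these
    are monotone in both ([possig1]).  That c.e. sets may be used as conditions
    is Kleene's theorem that graphs of partial recursive functions are
    Sigma-1 ([possig1_partial_recursive]). *)

Import CodeSeq.

(** * Total recursive functions of lists *)

(** Environments are lists, so that a quantified variable is bound by consing a
    value and the outer variables are reached through [behead]. *)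
Definition recfun k (f : seq nat -> nat) : Prop :=
  partial_recursive (fun v : k.-tuple nat => [set f v]).

Definition recpred k (d : seq nat -> bool) : Prop :=
  recfun k (fun e => nat_of_bool (d e)).

(** Substitutions, from environments of size [k] to environments of size [m].
    For [i >= m] the entry is the default value [0] on environments of size
    [k]. *)
Definition recenv k m (v : seq nat -> seq nat) : Prop :=
  (forall e, size e = k -> size (v e) = m) /\
  (forall i, recfun k (fun e => nth 0 (v e) i)).

Lemma eq_recfun k f g : f =1 g -> recfun k f -> recfun k g.
Proof. by move=> /funext ->. Qed.

Lemma head_iter_behead n (e : seq nat) : head 0 (iter n behead e) = nth 0 e n.
Proof. by elim: n e => [|n IH] [|x e] //; rewrite iterSr IH//= nth_nil. Qed.

Lemma recfun_nth n k : recfun k (fun e => nth 0 e n).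
Proof.
have [lt_nk|le_kn] := ltnP n k.
  have := partrec_proj (Ordinal lt_nk); congr partial_recursive.
  by apply/funext => v; rewrite (tnth_nth 0).
rewrite /recfun.
(* An index out of range reads the default value; in arity [k] the constant 0
   is the composite of the nullary zero with no arguments. *)
have -> : (fun v : k.-tuple nat => [set nth 0 v n]) =
    compose_pfun (fun _ : 0.-tuple nat => [set 0])
      (fun (_ : 'I_0) (_ : k.-tuple nat) => set0).
  apply/funext => v; rewrite nth_default ?size_tuple//.
  apply/seteqP; split => [y ->|y [w _ ->]//].
  by exists [tuple]; [case|].
by apply: partrec_comp => [|[]//]; exact: partrec_zero.
Qed.

Lemma recfun_var n k : recfun k (fun e => head 0 (iter n behead e)).
Proof.
by apply: eq_recfun (recfun_nth n k) => e; rewrite head_iter_behead.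
Qed.

Lemma recfun_subst k m (f : seq nat -> nat) (v : seq nat -> seq nat) :
  recfun m f -> recenv k m v -> recfun k (fun e => f (v e)).
Proof.
move=> rf [size_v rv].
have := partrec_comp rf (fun i : 'I_m => rv i); congr partial_recursive.
apply/funext => e; have /eqP size_ve := size_v _ (size_tuple e).
apply/seteqP; split => [y /= [w wE ->]|y ->].
  suff -> : w = Tuple size_ve by [].
  by apply: eq_from_tnth => i; rewrite wE (tnth_nth 0).
by exists (Tuple size_ve) => //= i; rewrite (tnth_nth 0).
Qed.

Lemma recenv_id k : recenv k k id.
Proof. by split=> // i; exact: recfun_nth. Qed.

Lemma recenv_behead k : recenv k.+1 k behead.
Proof.
split=> [e|i]; first by rewrite size_behead => ->.
by apply: eq_recfun (recfun_nth i.+1 _) => e; rewrite nth_behead.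
Qed.

Lemma recenv_cons k m a v :
  recfun k a -> recenv k m v -> recenv k m.+1 (fun e => a e :: v e).
Proof. by move=> ra [size_v rv]; split=> [e /size_v|[|i]] //= ->. Qed.

Lemma recfun_behead k f : recfun k f -> recfun k.+1 (fun e => f (behead e)).
Proof. by move=> rf; exact: recfun_subst rf (recenv_behead k). Qed.

Lemma recenv_comp k m n v w :
  recenv m n w -> recenv k m v -> recenv k n (fun e => w (v e)).
Proof.
move=> [size_w rw] rv; split=> [e /(proj1 rv)/size_w//|i].
exact: (recfun_subst (rw i) rv).
Qed.

Lemma recenv_nil k : recenv k 0 (fun=> [::]).
Proof.
split=> // i; have := recfun_nth k k; congr partial_recursive.
by apply/funext => v; rewrite nth_nil nth_default ?size_tuple.
Qed.

Lemma recfunS k f : recfun k f -> recfun k (fun e => (f e).+1).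
Proof.
move=> rf; have rS : recfun 1 (fun e => (head 0 e).+1).
  have := partrec_succ; congr partial_recursive.
  by apply/funext => v; congr [set _.+1]; rewrite [in RHS](tuple_eta v).
exact: (recfun_subst rS (recenv_cons rf (recenv_nil k))).
Qed.

Lemma recfun_cst k c : recfun k (fun=> c).
Proof.
elim: c => [|c IH]; last exact: recfunS IH.
have r0 : recfun 0 (fun=> 0) by exact: partrec_zero.
exact: (recfun_subst r0 (recenv_nil k)).
Qed.

Lemma recfun_iteri k (n x : seq nat -> nat)
    (step : nat -> nat -> seq nat -> nat) :
  recfun k n -> recfun k x ->
  recfun k.+2 (fun e =>
    step (head 0 e) (head 0 (behead e)) (behead (behead e))) ->
  recfun k (fun e => iteri (n e) (fun p r => step p r e) (x e)).
Proof.
move=> rn rx rs.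
have := partrec_rec rx rs => rec.
have {}rec : recfun k.+1 (fun e => iteri (head 0 e)
    (fun p r => step p r (behead e)) (x (behead e))).
  move: rec; congr partial_recursive; apply/funext => v.
  rewrite [in RHS](tuple_eta v) /=.
  elim: (thead v) => [//|p IH] /=; rewrite IH.
  by apply/seteqP; split => [y /= [r -> ->]|y ->]; last eexists.
exact: (recfun_subst rec (recenv_cons rn (recenv_id k))).
Qed.

Lemma recfunD k f g : recfun k f -> recfun k g -> recfun k (fun e => f e + g e).
Proof.
move=> rf rg; have rS := recfunS (recfun_var 1 k.+2).
apply: eq_recfun (recfun_iteri (step := fun _ r _ => r.+1) rg rf rS) => e.
by elim: (g e) => [|n IH] /=; rewrite ?addn0// IH addnS.
Qed.

Lemma recfun_pred k f : recfun k f -> recfun k (fun e => (f e).-1).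
Proof.
move=> rf; have rp := recfun_var 0 k.+2.
apply: eq_recfun (recfun_iteri (step := fun p _ _ => p) rf (recfun_cst k 0) rp).
by move=> e; case: (f e).
Qed.

Lemma recfunM k f g : recfun k f -> recfun k g -> recfun k (fun e => f e * g e).
Proof.
move=> rf rg.
have rs := recfunD (recfun_var 1 k.+2) (recfun_behead (recfun_behead rf)).
apply: eq_recfun
  (recfun_iteri (step := fun _ r e => r + f e) rg (recfun_cst k 0) rs) => e.
by elim: (g e) => [|n IH] /=; rewrite ?muln0// IH mulnS addnC.
Qed.

Lemma recfunB k f g : recfun k f -> recfun k g -> recfun k (fun e => f e - g e).
Proof.
move=> rf rg; have rp := recfun_pred (recfun_var 1 k.+2).
apply: eq_recfun (recfun_iteri (step := fun _ r _ => r.-1) rg rf rp) => e.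
by elim: (g e) => [|n IH] /=; rewrite ?subn0// IH subnS.
Qed.

Lemma recfun_double k f : recfun k f -> recfun k (fun e => (f e).*2).
Proof. by move=> rf; apply: eq_recfun (recfunD rf rf) => e; rewrite addnn. Qed.

Lemma recfun_exp2 k f : recfun k f -> recfun k (fun e => 2 ^ f e).
Proof.
move=> rf; have rd := recfunD (recfun_var 1 k.+2) (recfun_var 1 k.+2).
apply: eq_recfun
  (recfun_iteri (step := fun _ r _ => r + r) rf (recfun_cst k 1) rd) => e.
by elim: (f e) => [|n IH] //=; rewrite IH addnn -mul2n expnS.
Qed.

Lemma eq_recpred k d d' : d =1 d' -> recpred k d -> recpred k d'.
Proof. by move=> /funext ->. Qed.

Lemma recpredN k d : recpred k d -> recpred k (fun e => ~~ d e).
Proof.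
by move=> rd; apply: eq_recfun (recfunB (recfun_cst k 1) rd) => e; case: (d e).
Qed.

Lemma recpredI k d d' :
  recpred k d -> recpred k d' -> recpred k (fun e => d e && d' e).
Proof.
by move=> rd rd'; apply: eq_recfun (recfunM rd rd') => e; rewrite mulnb.
Qed.

Lemma recpredU k d d' :
  recpred k d -> recpred k d' -> recpred k (fun e => d e || d' e).
Proof.
move=> rd rd'; apply: eq_recpred
  (recpredN (recpredI (recpredN rd) (recpredN rd'))).
by move=> e; rewrite negb_and !negbK.
Qed.

Lemma recpred_leq k f g :
  recfun k f -> recfun k g -> recpred k (fun e => f e <= g e).
Proof.
move=> rf rg; apply: eq_recfun (recfunB (recfun_cst k 1) (recfunB rf rg)) => e.
by rewrite /leq; case: (f e - g e).
Qed.

Lemma recpred_eq k f g :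
  recfun k f -> recfun k g -> recpred k (fun e => f e == g e).
Proof.
move=> rf rg; apply: eq_recpred
  (recpredI (recpred_leq rf rg) (recpred_leq rg rf)).
by move=> e; rewrite eqn_leq.
Qed.

(** The variable bound by [has] becomes the head of the environment; in this
    form goals about nested binders are solved by syntactic recursion. *)
Lemma recpred_has k (d : nat -> seq nat -> bool) n :
  recpred k.+1 (fun e => d (head 0 e) (behead e)) -> recfun k n ->
  recpred k (fun e => has (fun i => d i e) (iota 0 (n e))).
Proof.
move=> rd rn.
have rv := recenv_cons (recfun_var 0 k.+2)
  (recenv_comp (recenv_behead k) (recenv_behead k.+1)).
have rs := recpredU (recpred_leq (recfun_cst _ 1) (recfun_var 1 k.+2))
  (recfun_subst rd rv).
apply: eq_recfun (recfun_iteri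
  (step := fun p r e => (0 < r) || d p e) rn (recfun_cst k 0) rs) => e.
elim: (n e) => [//|m IH]; rewrite iteriS IH -[m.+1]addn1 iotaD has_cat /= orbF.
by case: has.
Qed.

Lemma recpred_all k (d : nat -> seq nat -> bool) n :
  recpred k.+1 (fun e => d (head 0 e) (behead e)) -> recfun k n ->
  recpred k (fun e => all (fun i => d i e) (iota 0 (n e))).
Proof.
move=> rd rn; apply: eq_recpred
  (recpredN (recpred_has (d := fun i e => ~~ d i e) (recpredN rd) rn)) => e.
by rewrite -all_predC; apply: eq_all => i /=; rewrite negbK.
Qed.

Lemma minimize_recpred k (q : nat -> seq nat -> bool) :
  recpred k.+1 (fun e => q (head 0 e) (behead e)) ->
  partial_recursive (fun v : k.-tuple nat =>
    [set y | q y v /\ forall z, z < y -> ~~ q z v]).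
Proof.
move=> /recpredN/partrec_min; congr partial_recursive.
apply/funext => v; apply/seteqP; split => y /= [qy lt_q]; split.
- by case: (q y v) qy.
- by move=> z /lt_q[r]; case: (q z v).
- by rewrite qy.
- by move=> z /lt_q ->; exists 0.
Qed.

(** Minimization computes a total function from a recursive graph. *)
Lemma recfun_graph k f (q : nat -> seq nat -> bool) :
  (forall y e, q y e = (y == f e)) ->
  recpred k.+1 (fun e => q (head 0 e) (behead e)) -> recfun k f.
Proof.
move=> qE /minimize_recpred; congr partial_recursive.
apply/funext => v; apply/seteqP; split => y /=; rewrite qE.
  by move=> [/eqP ->].
by move=> ->; rewrite eqxx; split=> // z lt_z; rewrite qE neq_ltn lt_z.
Qed.

Lemma ce_recpred (q : nat -> nat -> bool) :
  recpred 2 (fun e => q (head 0 e) (head 0 (behead e))) ->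
  ce [set x | exists b, q b x].
Proof.
move=> /(minimize_recpred (q := fun b e => q b (head 0 e))) rmin.
eexists; first exact: rmin.
apply/seteqP; split => x /= [b]; last by case=> qb _; exists b.
move=> qb; have ex_q : exists b, q b x by exists b.
exists (ex_minn ex_q); case: ex_minnP => m qm min_m; split=> // z.
by rewrite ltnNge; apply: contra => /min_m.
Qed.

(* Extended below with the operations on list codes. *)
Ltac rec_code := fail.

Ltac rec_step :=
  lazymatch goal with
  | |- recfun _ (fun _ => ?c) => exact: recfun_cst
  | |- recfun _ (fun e => (@?f e).+1) => apply: (@recfunS _ f)
  | |- recfun _ (fun e => (@?f e).-1) => apply: (@recfun_pred _ f)
  | |- recfun _ (fun e => @?f e + @?g e) => apply: (@recfunD _ f g)
  | |- recfun _ (fun e => @?f e - @?g e) => apply: (@recfunB _ f g)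
  | |- recfun _ (fun e => @?f e * @?g e) => apply: (@recfunM _ f g)
  | |- recfun _ (fun e => (@?f e).*2) => apply: (@recfun_double _ f)
  | |- recfun _ (fun e => 2 ^ (@?f e)) => apply: (@recfun_exp2 _ f)
  | |- recfun _ (fun e => head 0 _) =>
      first [ exact: (recfun_var 0) | exact: (recfun_var 1)
            | exact: (recfun_var 2) | exact: (recfun_var 3)
            | exact: (recfun_var 4) | exact: (recfun_var 5)
            | exact: (recfun_var 6) | exact: (recfun_var 7) ]
  | |- recpred _ (fun e => ~~ (@?d e)) => apply: (@recpredN _ d)
  | |- recpred _ (fun e => (@?d e) && (@?d' e)) => apply: (@recpredI _ d d')
  | |- recpred _ (fun e => (@?d e) || (@?d' e)) => apply: (@recpredU _ d d')
  | |- recpred _ (fun e => @?f e <= @?g e) => apply: (@recpred_leq _ f g)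
  | |- recpred _ (fun e => @?f e == @?g e) => apply: (@recpred_eq _ f g)
  | |- recpred _ (fun e => has (fun i => @?d e i) (iota 0 (@?n e))) =>
      refine (@recpred_has _ (fun i e => d e i) n _ _)
  | |- recpred _ (fun e => all (fun i => @?d e i) (iota 0 (@?n e))) =>
      refine (@recpred_all _ (fun i e => d e i) n _ _)
  | _ => rec_code
  end; cbv beta.

Ltac rec_auto := cbv beta; repeat (first [assumption | rec_step]).

(** * Recursive operations on list codes *)

Lemma code_consE x s : code (x :: s) = 2 ^ x * (code s).*2.+1.
Proof. by []. Qed.

Lemma recfun_code_cons k f g : recfun k f -> recfun k g ->
  recfun k (fun e => code (f e :: decode (g e))).
Proof.
move=> rf rg; apply: (@eq_recfun _ (fun e => 2 ^ f e * (g e).*2.+1)).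
  by move=> e; rewrite code_consE decodeK.
by rec_auto.
Qed.

(** A nonzero code factors uniquely as [2 ^ x * m.*2.+1], with [x] the head and
    [m] the code of the tail, both below the code; hence a recursive graph. *)
Lemma decode_head_graph y z : (y == head 0 (decode z)) =
  (z == 0) && (y == 0) || has (fun m => z == 2 ^ y * m.*2.+1) (iota 0 z).
Proof.
rewrite -[z in RHS]decodeK; case: (decode z) => [|x s] //=.
  by rewrite orbF.
have codeE0 : code (x :: s) != 0 by rewrite -lt0n muln_gt0 expn_gt0.
apply/eqP/idP => [->|].
  apply/orP; right; apply/hasP; exists (code s); last by [].
  rewrite mem_iota /= add0n; apply: (@leq_ltn_trans (code s).*2).
    by rewrite -addnn leq_addr.
  by rewrite leq_pmull// expn_gt0.
case/orP => [/andP[/eqP E _]|/hasP[m _ /eqP E]].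
  by move: codeE0 => /=; rewrite E.
have : code (x :: s) = code (y :: decode m) by rewrite !code_consE decodeK.
by move/(can_inj codeK) => [].
Qed.

Lemma decode_behead_graph y z : (y == code (behead (decode z))) =
  (z == 0) && (y == 0) || has (fun m => z == 2 ^ m * y.*2.+1) (iota 0 z).
Proof.
rewrite -[z in RHS]decodeK; case: (decode z) => [|x s] //=.
  by rewrite orbF.
have codeE0 : code (x :: s) != 0 by rewrite -lt0n muln_gt0 expn_gt0.
apply/eqP/idP => [->|].
  apply/orP; right; apply/hasP; exists x; last by [].
  by rewrite mem_iota /= add0n; have /andP[] := ltn_code (x :: s).
case/orP => [/andP[/eqP E _]|/hasP[m _ /eqP E]].
  by move: codeE0 => /=; rewrite E.
have : code (x :: s) = code (m :: decode y) by rewrite !code_consE decodeK.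
by move/(can_inj codeK) => [_ ->]; rewrite decodeK.
Qed.

Lemma recfun_head_decode k f :
  recfun k f -> recfun k (fun e => head 0 (decode (f e))).
Proof.
have r1 : recfun 1 (fun e => head 0 (decode (head 0 e))).
  apply: (recfun_graph (q := fun y e => (head 0 e == 0) && (y == 0) ||
    has (fun m => head 0 e == 2 ^ y * m.*2.+1) (iota 0 (head 0 e)))).
    by move=> y e; rewrite decode_head_graph.
  by rec_auto.
by move=> rf; exact: (recfun_subst r1 (recenv_cons rf (recenv_nil k))).
Qed.

Lemma recfun_behead_decode k f :
  recfun k f -> recfun k (fun e => code (behead (decode (f e)))).
Proof.
have r1 : recfun 1 (fun e => code (behead (decode (head 0 e)))).
  apply: (recfun_graph (q := fun y e => (head 0 e == 0) && (y == 0) ||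
    has (fun m => head 0 e == 2 ^ m * y.*2.+1) (iota 0 (head 0 e)))).
    by move=> y e; rewrite decode_behead_graph.
  by rec_auto.
by move=> rf; exact: (recfun_subst r1 (recenv_cons rf (recenv_nil k))).
Qed.

Lemma recfun_drop_decode k f g : recfun k f -> recfun k g ->
  recfun k (fun e => code (drop (g e) (decode (f e)))).
Proof.
move=> rf rg; have rs := recfun_behead_decode (recfun_var 1 k.+2).
apply: eq_recfun (recfun_iteri
  (step := fun _ r _ => code (behead (decode r))) rg rf rs) => e.
elim: (g e) => [|n IH] /=; first by rewrite drop0 decodeK.
by rewrite IH codeK -drop1 drop_drop add1n.
Qed.

Lemma recfun_nth_decode k f g : recfun k f -> recfun k g ->
  recfun k (fun e => nth 0 (decode (f e)) (g e)).
Proof.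
move=> rf rg; apply: eq_recfun (recfun_head_decode (recfun_drop_decode rf rg)).
by move=> e; rewrite codeK -nth0 nth_drop addn0.
Qed.

Lemma code_eq0 s : (code s == 0) = (s == [::]).
Proof. by case: s => //= x s; rewrite muln_eq0 expn_eq0. Qed.

Lemma recfun_size_decode k f :
  recfun k f -> recfun k (fun e => size (decode (f e))).
Proof.
have r1 : recfun 1 (fun e => size (decode (head 0 e))).
  apply: (recfun_graph (q := fun y e => (code (drop y (decode (head 0 e))) == 0)
    && ((y == 0) || ~~ (code (drop y.-1 (decode (head 0 e))) == 0)))).
    move=> y e; rewrite !code_eq0 -!size_eq0 !size_drop !subn_eq0.
    case: y => [|y] /=; first by rewrite andbT leqn0 eq_sym.
    by rewrite -ltnNge -eqn_leq eq_sym.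
  have rdrop0 := recfun_drop_decode (recfun_var 1 2) (recfun_var 0 2).
  have rdrop1 := recfun_drop_decode (recfun_var 1 2)
    (recfun_pred (recfun_var 0 2)).
  by rec_auto.
by move=> rf; exact: (recfun_subst r1 (recenv_cons rf (recenv_nil k))).
Qed.

Lemma recfun_pair k f g : recfun k f -> recfun k g ->
  recfun k (fun e => pair_code (f e) (g e)).
Proof.
move=> rf rg.
have := recfun_code_cons rf (recfun_code_cons rg (recfun_cst k 0)).
by apply: eq_recfun => e; rewrite codeK.
Qed.

Ltac rec_code ::=
  lazymatch goal with
  | |- recfun _ (fun e => nth 0 (decode (@?f e)) (@?g e)) =>
      apply: (@recfun_nth_decode _ f g)
  | |- recfun _ (fun e => size (decode (@?f e))) =>
      apply: (@recfun_size_decode _ f)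
  | |- recfun _ (fun e => pair_code (@?f e) (@?g e)) =>
      apply: (@recfun_pair _ f g)
  end.

Lemma recpred_mem_decode k f g : recfun k f -> recfun k g ->
  recpred k (fun e => f e \in decode (g e)).
Proof.
move=> rf rg; have r2 : recpred 2 (fun e => has (fun i =>
    nth 0 (decode (head 0 (behead e))) i == head 0 e)
    (iota 0 (size (decode (head 0 (behead e)))))) by rec_auto.
have rv := recenv_cons rf (recenv_cons rg (recenv_nil k)).
apply: eq_recfun (recfun_subst r2 rv) => e /=; congr nat_of_bool.
apply/hasP/idP => [[i]|/nthP-/(_ 0)[i lt_i <-]].
  by rewrite mem_iota => lt_i /eqP <-; rewrite mem_nth.
by exists i; rewrite ?mem_iota//=.
Qed.

(** * Positive Sigma-1 predicates of a set *)

(** [Q b c e] approximates [P X e]: the existential quantifiers are bounded by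
    [b], and [X] is replaced by the finite set of the members of the list with
    code [c].  Monotonicity lets two approximations be merged, which makes the
    class closed under conjunction and bounded universal quantification. *)
Definition possig1 k (P : set nat -> seq nat -> Prop) : Prop :=
  exists Q : nat -> nat -> seq nat -> bool,
  [/\ recpred k.+2
        (fun e => Q (head 0 e) (head 0 (behead e)) (behead (behead e))),
      forall b b' c c' e, b <= b' -> {subset decode c <= decode c'} ->
        Q b c e -> Q b' c' e
    & forall X e, P X e <->
        exists b c, [set` decode c] `<=` X /\ Q b c e].

Lemma eq_possig1 k (P P' : set nat -> seq nat -> Prop) :
  (forall X e, P' X e <-> P X e) -> possig1 k P -> possig1 k P'.
Proof. by move=> PP' [Q [rQ mQ PQ]]; exists Q; split=> // X e; rewrite PP'. Qed.

Lemma recpred_behead2 k d :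
  recpred k d -> recpred k.+2 (fun e => d (behead (behead e))).
Proof.
by move=> rd; exact: (recfun_subst rd
  (recenv_comp (recenv_behead k) (recenv_behead k.+1))).
Qed.

Lemma possig1_rec k d : recpred k d -> possig1 k (fun _ e => d e).
Proof.
move=> rd; exists (fun _ _ e => d e); split=> [|//|X e].
  exact: recpred_behead2.
by split=> [de|[b [c []]]//]; exists 0, 0.
Qed.

Lemma possig1_mem k f : recfun k f -> possig1 k (fun X e => X (f e)).
Proof.
move=> rf; exists (fun _ c e => f e \in decode c); split.
- apply: recpred_mem_decode; last exact: recfun_var 1 _.
  exact: (recfun_behead (recfun_behead rf)).
- by move=> b b' c c' e _; exact.
- move=> X e; split=> [Xfe|[_ [c [cX fc]]]]; last exact: cX.
  exists 0, (code [:: f e]); rewrite codeK inE eqxx; split=> // x /=.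
  by rewrite inE => /eqP ->.
Qed.

Lemma sub_decode_cat c c' :
  {subset decode c <= decode (code (decode c ++ decode c'))} /\
  {subset decode c' <= decode (code (decode c ++ decode c'))}.
Proof. by rewrite codeK; split=> x xc; rewrite mem_cat xc ?orbT. Qed.

Lemma sub_set_cat c c' (X : set nat) :
  [set` decode c] `<=` X -> [set` decode c'] `<=` X ->
  [set` decode (code (decode c ++ decode c'))] `<=` X.
Proof. by rewrite codeK => cX c'X x /=; rewrite mem_cat => /orP[/cX|/c'X]. Qed.

Lemma possig1_and k P P' : possig1 k P -> possig1 k P' ->
  possig1 k (fun X e => P X e /\ P' X e).
Proof.
move=> [Q [rQ mQ PQ]] [Q' [rQ' mQ' PQ']].
exists (fun b c e => Q b c e && Q' b c e); split.
- exact: recpredI rQ rQ'.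
- move=> b b' c c' e le_b sub_c /andP[Qe Q'e].
  by apply/andP; split; [exact: mQ Qe|exact: mQ' Q'e].
move=> X e; rewrite PQ PQ'; split.
  move=> [[b [c [cX Qe]]] [b' [c' [c'X Q'e]]]].
  have [sub_c sub_c'] := sub_decode_cat c c'.
  exists (maxn b b'), (code (decode c ++ decode c')); split.
    exact: sub_set_cat.
  apply/andP; split.
    exact: mQ (leq_maxl b b') sub_c Qe.
  exact: mQ' (leq_maxr b b') sub_c' Q'e.
by move=> [b [c [cX /andP[Qe Q'e]]]]; split; exists b, c.
Qed.

Lemma possig1_or k P P' : possig1 k P -> possig1 k P' ->
  possig1 k (fun X e => P X e \/ P' X e).
Proof.
move=> [Q [rQ mQ PQ]] [Q' [rQ' mQ' PQ']].
exists (fun b c e => Q b c e || Q' b c e); split.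
- exact: recpredU rQ rQ'.
- move=> b b' c c' e le_b sub_c /orP[] H; apply/orP.
    by left; apply: mQ H.
  by right; apply: mQ' H.
move=> X e; rewrite PQ PQ'; split.
  by move=> [] [b [c [cX Qe]]]; exists b, c; rewrite Qe ?orbT.
by move=> [b [c [cX /orP[]]]]; [left|right]; exists b, c.
Qed.

(** Quantifying over a variable below the two approximation parameters moves
    that variable from the front of the environment to behind them. *)
Lemma recpred_rotate k (Q : nat -> nat -> seq nat -> bool) :
  recpred k.+3
    (fun e => Q (head 0 e) (head 0 (behead e)) (behead (behead e))) ->
  recpred k.+3 (fun e => Q (head 0 (behead e)) (head 0 (behead (behead e)))
                           (head 0 e :: behead (behead (behead e)))).
Proof.
move=> rQ; have r3 : recenv k.+3 k (fun e => behead (behead (behead e))).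
  exact: recenv_comp (recenv_behead k)
    (recenv_comp (recenv_behead k.+1) (recenv_behead k.+2)).
exact: (recfun_subst rQ (recenv_cons (recfun_var 1 k.+3)
  (recenv_cons (recfun_var 2 k.+3) (recenv_cons (recfun_var 0 k.+3) r3)))).
Qed.

Lemma possig1_subst k m P v : possig1 m P -> recenv k m v ->
  possig1 k (fun X e => P X (v e)).
Proof.
move=> [Q [rQ mQ PQ]] rv; exists (fun b c e => Q b c (v e)); split=> //.
  have rv2 := recenv_comp rv
    (recenv_comp (recenv_behead k) (recenv_behead k.+1)).
  exact: (recfun_subst rQ (recenv_cons (recfun_var 0 k.+2)
    (recenv_cons (recfun_var 1 k.+2) rv2))).
by move=> b b' c c' e; exact: mQ.
Qed.

Lemma possig1_subst1 k P f : possig1 1 P -> recfun k f ->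
  possig1 k (fun X e => P X [:: f e]).
Proof.
by move=> sP rf; exact: possig1_subst sP (recenv_cons rf (recenv_nil k)).
Qed.

Lemma possig1_ex k (P : nat -> set nat -> seq nat -> Prop) :
  possig1 k.+1 (fun X e => P (head 0 e) X (behead e)) ->
  possig1 k (fun X e => exists y, P y X e).
Proof.
move=> [Q [rQ mQ PQ]].
exists (fun b c e => has (fun y => Q b c (y :: e)) (iota 0 b)); split.
- apply: (@recpred_has _ (fun y e => Q (head 0 e) (head 0 (behead e))
    (y :: behead (behead e))) (head 0)); last exact: recfun_var 0 _.
  exact: recpred_rotate.
- move=> b b' c c' e le_b sub_c /hasP[y]; rewrite mem_iota /= => lt_y Qy.
  apply/hasP; exists y; first by rewrite mem_iota /=; exact: leq_trans le_b.
  exact: mQ le_b sub_c Qy.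
move=> X e; split.
  move=> [y /(PQ X (y :: e))[b [c [cX Qy]]]].
  exists (maxn b y.+1), c; split=> //.
  apply/hasP; exists y; first by rewrite mem_iota /= leq_maxr.
  by apply: mQ Qy => //; rewrite leq_maxl.
move=> [b [c [cX /hasP[y _ Qy]]]]; exists y.
by apply/(PQ X (y :: e)); exists b, c.
Qed.

Lemma possig1_all k (P : nat -> set nat -> seq nat -> Prop) n :
  recfun k n -> possig1 k.+1 (fun X e => P (head 0 e) X (behead e)) ->
  possig1 k (fun X e => forall i, i < n e -> P i X e).
Proof.
move=> rn [Q [rQ mQ PQ]].
exists (fun b c e => all (fun i => Q b c (i :: e)) (iota 0 (n e))); split.
- apply: (@recpred_all _ (fun y e => Q (head 0 e) (head 0 (behead e))
    (y :: behead (behead e)))); last exact: recfun_behead (recfun_behead rn).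
  exact: recpred_rotate.
- move=> b b' c c' e le_b sub_c /allP Qe.
  by apply/allP => i /Qe; exact: mQ.
move=> X e; split; last first.
  move=> [b [c [cX /allP Qe]]] i lt_i; apply/(PQ X (i :: e)); exists b, c.
  by split=> //; apply: Qe; rewrite mem_iota.
elim: (n e) => [|m IH] Pe; first by exists 0, 0.
have [|b [c [cX /allP Qe]]] := IH; first by move=> i /ltnW; exact: Pe.
have /(PQ X (m :: e))[b' [c' [c'X Qm]]] := Pe m (leqnn _).
have [sub_c sub_c'] := sub_decode_cat c c'.
exists (maxn b b'), (code (decode c ++ decode c')); split.
  exact: sub_set_cat.
apply/allP => i; rewrite mem_iota /= ltnS leq_eqVlt => /predU1P[->|lt_i].
  exact: mQ (leq_maxr b b') sub_c' Qm.
by apply: mQ (leq_maxl b b') sub_c (Qe i _); rewrite mem_iota.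
Qed.

Lemma possig1_forall_ord k m (P : 'I_m -> set nat -> seq nat -> Prop) :
  (forall i, possig1 k (P i)) -> possig1 k (fun X e => forall i, P i X e).
Proof.
elim: m P => [|m IH] P sP.
  apply: eq_possig1 (possig1_rec (d := fun=> true) (recfun_cst k 1)) => X e.
  by split=> // _ [].
apply: eq_possig1 (possig1_and (sP ord0) (IH _ (fun i => sP (lift ord0 i)))).
move=> X e; split=> [Pe|[P0 PS] i]; first by split.
by case: (unliftP ord0 i) => [j ->|->].
Qed.

(** * Graphs of partial recursive functions are Sigma-1 *)

(** The values of a primitive recursion are collected in a single list, so
    that they can be quantified as one number. *)
Lemma primrec_pfunP k (phi : k.-tuple nat -> set nat) psi v n y :
  primrec_pfun phi psi v n y <->
  exists s : seq nat, [/\ phi v (nth 0 s 0),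
    forall p, p < n -> psi [tuple of p :: nth 0 s p :: v] (nth 0 s p.+1)
    & nth 0 s n = y].
Proof.
split=> [|[s [s0 sS <-]]]; last first.
  elim: n sS => [//|n IH] sS /=; exists (nth 0 s n); last exact: sS.
  by apply: IH => p lt_p; apply: sS; exact: ltnW.
suff: primrec_pfun phi psi v n y -> exists r : nat -> nat, [/\ phi v (r 0),
    forall p, p < n -> psi [tuple of p :: r p :: v] (r p.+1) & r n = y].
  move=> /[apply] -[r [r0 rS rn]]; exists (mkseq r n.+1).
  split=> [|p lt_p|]; rewrite !nth_mkseq//; [exact: rS|exact: ltnW].
elim: n y => [|n IH] y /=; first by move=> phiy; exists (fun=> y).
move=> [z /IH[r [r0 rS rn]] psiy].
exists (fun i => if i <= n then r i else y); split=> [//||].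
  2: by rewrite ltnn.
move=> p /=; rewrite ltnS => le_p; rewrite le_p; move: le_p.
rewrite leq_eqVlt => /predU1P[->|lt_p].
  by rewrite ltnn rn.
by rewrite lt_p; exact: rS.
Qed.

(** Arguments and value are arbitrary recursive functions of the environment,
    so that the induction hypotheses apply under the quantifiers that
    composition, recursion and minimization introduce. *)
Lemma possig1_partial_recursive m (phi : m.-tuple nat -> set nat) :
  partial_recursive phi ->
  forall k (v : seq nat -> m.-tuple nat) (y : seq nat -> nat),
    recenv k m (fun e => v e) -> recfun k y ->
    possig1 k (fun _ e => phi (v e) (y e)).
Proof.
have rtnth k n (v : seq nat -> n.-tuple nat) i :
    recenv k n (fun e => v e) -> recfun k (fun e => tnth (v e) i).
  by move=> [_ /(_ i)]; apply: eq_recfun => e; rewrite (tnth_nth 0).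
elim=> {m phi}.
- move=> k v y _ ry.
  apply: eq_possig1 (possig1_rec (recpred_eq ry (recfun_cst k 0))) => X e.
  by split=> /eqP.
- move=> k v y rv ry.
  apply: eq_possig1
    (possig1_rec (recpred_eq ry (recfunS (rtnth _ _ _ ord0 rv)))).
  by move=> X e; split=> /eqP.
- move=> n i k v y rv ry.
  apply: eq_possig1 (possig1_rec (recpred_eq ry (rtnth _ _ _ i rv))) => X e.
  by split=> /eqP.
- move=> n m phi psi _ IHphi _ IHpsi k v y rv ry.
  pose w (c : nat) := [tuple nth 0 (decode c) i | i < m].
  have rv' : recenv k.+1 n (fun e => v (behead e)).
    exact: recenv_comp rv (recenv_behead k).
  apply: (@eq_possig1 _ (fun _ e => exists c,
      (forall i, psi i (v e) (nth 0 (decode c) i)) /\ phi (w c) (y e))).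
    move=> _ e; split=> [[u psiu phiu]|[c [psic phic]]].
      exists (code u); rewrite /w codeK; split=> [i|].
        by rewrite -tnth_nth.
      suff -> : [tuple nth 0 u i | i < m] = u by [].
      by apply: eq_from_tnth => i; rewrite tnth_mktuple (tnth_nth 0).
    by exists (w c) => // i; rewrite tnth_mktuple.
  apply: (@possig1_ex _ (fun c _ e =>
    (forall i, psi i (v e) (nth 0 (decode c) i)) /\ phi (w c) (y e))).
  apply: possig1_and.
    apply: possig1_forall_ord => i; apply: IHpsi => //.
    by rec_auto.
  apply: IHphi; last exact: recfun_behead.
  split=> [e _|i]; first by rewrite size_tuple.
  have [lt_im|le_mi] := ltnP i m.
    have r : recfun k.+1 (fun e => nth 0 (decode (head 0 e)) i) by rec_auto.
    apply: eq_recfun r => e.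
    by rewrite -(tnth_nth 0 (w (head 0 e)) (Ordinal lt_im)) tnth_mktuple.
  apply: eq_recfun (recfun_cst _ 0) => e.
  by rewrite nth_default// size_tuple.
- move=> n phi psi _ IHphi _ IHpsi k v y rv ry.
  have rv' : recenv k n (fun e => [tuple of behead (v e)]).
    exact: recenv_comp (recenv_behead n) rv.
  have rv1 : recenv k.+1 n (fun e => [tuple of behead (v (behead e))]).
    exact: recenv_comp rv' (recenv_behead k).
  have rn : recfun k (fun e => thead (v e)) := rtnth _ _ _ ord0 rv.
  apply: (@eq_possig1 _ (fun _ e => exists c,
      phi [tuple of behead (v e)] (nth 0 (decode c) 0) /\
      (forall p, p < thead (v e) ->
         psi [tuple of p :: nth 0 (decode c) p :: behead (v e)]
           (nth 0 (decode c) p.+1)) /\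
      nth 0 (decode c) (thead (v e)) == y e)).
    move=> _ e; rewrite primrec_pfunP.
    split=> [[s [s0 sS sn]]|[c [c0 [cS /eqP cn]]]].
      by exists (code s); rewrite codeK; split=> //; split=> //; apply/eqP.
    by exists (decode c).
  apply: (@possig1_ex _ (fun c _ e =>
      phi [tuple of behead (v e)] (nth 0 (decode c) 0) /\
      (forall p, p < thead (v e) ->
         psi [tuple of p :: nth 0 (decode c) p :: behead (v e)]
           (nth 0 (decode c) p.+1)) /\
      nth 0 (decode c) (thead (v e)) == y e)).
  have rn1 := recfun_behead rn.
  apply: possig1_and; first by apply: IHphi => //; rec_auto.
  apply: possig1_and.
    apply: (@possig1_all _ (fun p _ e =>
      psi [tuple of p :: nth 0 (decode (head 0 e)) p :: behead (v (behead e))]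
           (nth 0 (decode (head 0 e)) p.+1)) _ rn1).
    apply: IHpsi; last by rec_auto.
    have rr : recfun k.+2
        (fun e => nth 0 (decode (head 0 (behead e))) (head 0 e)).
      by rec_auto.
    exact: (recenv_cons (recfun_var 0 _) (recenv_cons rr
      (recenv_comp rv1 (recenv_behead k.+1)))).
  apply: possig1_rec; apply: recpred_eq; last exact: recfun_behead.
  by rec_auto.
- move=> n phi _ IHphi k v y rv ry.
  apply: (@eq_possig1 _ (fun _ e => phi [tuple of y e :: v e] 0 /\
      forall z, z < y e -> exists r, phi [tuple of z :: v e] r.+1)) => //.
  apply: possig1_and.
    apply: IHphi (recfun_cst _ 0); exact: recenv_cons.
  apply: (@possig1_all _ (fun z _ e =>
    exists r, phi [tuple of z :: v e] r.+1)) => //.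
  apply: (@possig1_ex _ (fun r _ e =>
    phi [tuple of head 0 e :: v (behead e)] r.+1)).
  apply: IHphi; last by rec_auto.
  apply: (recenv_cons (recfun_var 1 _)).
  exact: recenv_comp rv (recenv_comp (recenv_behead k) (recenv_behead k.+1)).
Qed.

Lemma possig1_ce k W f : ce W -> recfun k f -> possig1 k (fun _ e => W (f e)).
Proof.
move=> [phi rphi ->] rf.
apply: (@possig1_ex _ (fun y _ e => phi [tuple f e] y)).
apply: (possig1_partial_recursive rphi (v := fun e => [tuple f (behead e)])).
  exact: recenv_cons (recfun_behead rf) (recenv_nil _).
exact: recfun_var 0 _.
Qed.

Ltac ps_step :=
  lazymatch goal with
  | |- possig1 _ (fun X e => @?P X e /\ @?P' X e) =>
      refine (@possig1_and _ P P' _ _)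
  | |- possig1 _ (fun X e => @?P X e \/ @?P' X e) =>
      refine (@possig1_or _ P P' _ _)
  | |- possig1 _ (fun X e => exists y : nat, @?P X e y) =>
      refine (@possig1_ex _ (fun y X e => P X e y) _)
  | |- possig1 _ (fun X e =>
      forall i : nat, is_true (i < @?n e) -> @?P X e i) =>
      refine (@possig1_all _ (fun i X e => P X e i) n _ _)
  | |- possig1 _ (fun X e => X (@?f e)) => refine (@possig1_mem _ f _)
  | |- possig1 _ (fun X e => is_true (@?d e)) => refine (@possig1_rec _ d _)
  | H : possig1 1 ?P |- possig1 _ (fun X e => ?P X [:: @?f e]) =>
      refine (@possig1_subst1 _ P f H _)
  | H : ce ?W |- possig1 _ (fun X e => ?W (@?f e)) =>
      refine (@possig1_ce _ W f H _)
  end; cbv beta.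

Ltac ps_auto := cbv beta; repeat (first [assumption | ps_step | rec_step]).

(** * Enumeration reducibility *)

Lemma enum_appP Psi X x : enum_app Psi X x <->
  exists c, (forall i, i < size (decode c) -> X (nth 0 (decode c) i)) /\
    Psi (pair_code c x).
Proof.
split=> [[s [sX sPsi]]|[c [cX cPsi]]].
  exists (code s); rewrite codeK; split=> // i lt_i.
  by apply: sX; exact: mem_nth.
exists (decode c); rewrite decodeK; split=> // y /= /nthP-/(_ 0)[i lt_i <-].
exact: cX.
Qed.

(** The enumeration operator of a positive Sigma-1 predicate consists of the
    pairs of a finite set and an element for which some approximation holds. *)
Lemma enum_reducible_possig1 Y X :
  enum_reducible Y X <->
  exists2 P, possig1 1 P & forall x, Y x <-> P X [:: x].
Proof.
split=> [[Psi cePsi ->]|[P [Q [rQ mQ PQ]] YP]].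
  exists (fun X e => exists c : nat,
      (forall i, i < size (decode c) -> X (nth 0 (decode c) i)) /\
      Psi (pair_code c (head 0 e))); first by ps_auto.
  by move=> x; exact: enum_appP.
exists [set z | exists b,
    Q b (nth 0 (decode z) 0) [:: nth 0 (decode z) 1] &&
    (z == pair_code (nth 0 (decode z) 0) (nth 0 (decode z) 1))].
  apply: (ce_recpred (q := fun b z =>
    Q b (nth 0 (decode z) 0) [:: nth 0 (decode z) 1] &&
    (z == pair_code (nth 0 (decode z) 0) (nth 0 (decode z) 1)))).
  apply: recpredI; last by rec_auto.
  have r c : recfun 2 (fun e => nth 0 (decode (head 0 (behead e))) c).
    by rec_auto.
  exact: (recfun_subst rQ (recenv_cons (recfun_var 0 2)
    (recenv_cons (r 0) (recenv_cons (r 1) (recenv_nil 2))))).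
apply/seteqP; split=> x.
  move=> /YP/PQ[b [c [cX Qb]]]; exists (decode c); split=> //; exists b.
  by rewrite /pair_code codeK /= decodeK Qb /=.
move=> [s [sX [b]]]; rewrite /pair_code codeK /= => /andP[Qb _].
by apply/YP/PQ; exists b, (code s); rewrite codeK.
Qed.

(** The tactic [ps_auto] proves the first premise by recursion on the formula,
    so a reduction amounts to writing down a formula for it. *)
Lemma enum_reducible_by (P : set nat -> nat -> Prop) Y X :
  possig1 1 (fun X e => P X (head 0 e)) -> (forall x, Y x <-> P X x) ->
  enum_reducible Y X.
Proof.
move=> sP YP; apply/enum_reducible_possig1.
by exists (fun X e => P X (head 0 e)).
Qed.

Lemma enum_reducible_refl X : enum_reducible X X.
Proof. by apply: (@enum_reducible_by (fun X x => X x)); ps_auto. Qed.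

Lemma enum_reducible_trans Y X Z :
  enum_reducible X Y -> enum_reducible Y Z -> enum_reducible X Z.
Proof.
move=> [Psi cePsi ->] /enum_reducible_possig1[P sP YP].
apply: (@enum_reducible_by (fun Z x => exists c : nat,
  (forall i, i < size (decode c) -> P Z [:: nth 0 (decode c) i]) /\
  Psi (pair_code c x))); first by ps_auto.
move=> x; rewrite enum_appP.
by split=> -[c [cP cPsi]]; exists c; split=> // i lt_i; apply/YP; exact: cP.
Qed.

Lemma enum_degree_eq X Y :
  enum_reducible X Y -> enum_reducible Y X -> enum_degree X = enum_degree Y.
Proof.
move=> XY YX; apply/seteqP; split=> Z [ZX XZ]; split;
  by [exact: enum_reducible_trans ZX _|exact: enum_reducible_trans XZ].
Qed.

Lemma join_double X Y x : join X Y x.*2 <-> X x.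
Proof.
split=> [[[y Xy /double_inj <-]//|[y _ E]]|Xx]; last by left; exists x.
by have := congr1 odd E; rewrite /= !odd_double.
Qed.

Lemma join_doubleS X Y x : join X Y x.*2.+1 <-> Y x.
Proof.
split=> [[[y _ E]|[y Yy [/double_inj <-]]//]|Yx]; last by right; exists x.
by have := congr1 odd E; rewrite /= !odd_double.
Qed.

Lemma enum_reducible_joinl X Y : enum_reducible X (join X Y).
Proof.
apply: (@enum_reducible_by (fun Z x => Z x.*2)); first by ps_auto.
by move=> x; rewrite join_double.
Qed.

Lemma enum_reducible_joinr X Y : enum_reducible Y (join X Y).
Proof.
apply: (@enum_reducible_by (fun Z x => Z x.*2.+1)); first by ps_auto.
by move=> x; rewrite join_doubleS.
Qed.

Lemma enum_reducible_join X Y Z :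
  enum_reducible X Z -> enum_reducible Y Z -> enum_reducible (join X Y) Z.
Proof.
move=> /enum_reducible_possig1[P sP XP] /enum_reducible_possig1[P' sP' YP'].
apply: (@enum_reducible_by (fun Z z => exists x : nat,
  P Z [:: x] /\ z == x.*2 \/ P' Z [:: x] /\ z == x.*2.+1)); first by ps_auto.
move=> z; split=> [[] [x]|[x [] [Px /eqP ->]]].
- by move=> /XP Px <-; exists x; left.
- by move=> /YP' Px <-; exists x; right.
- by apply/join_double/XP.
- by apply/join_doubleS/YP'.
Qed.

Lemma pair_code_inj a b c d : pair_code a b = pair_code c d -> a = c /\ b = d.
Proof. by move/(can_inj codeK) => [-> ->]. Qed.

Lemma graph_pair f x y : graph f (pair_code x y) <-> f x = y.
Proof.
split=> [[a [b [<- /pair_code_inj[-> ->]]]]//|fxy].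
by exists x, y.
Qed.

Lemma enum_reducible_graph f X :
  recfun 1 (fun e => f (head 0 e)) -> enum_reducible (graph f) X.
Proof.
move=> rf; apply: (@enum_reducible_by (fun _ z => exists x : nat,
    z == pair_code x (f x))); last first.
  move=> z; split=> [[x [_ [<- ->]]]|[x /eqP ->]]; last by exists x, (f x).
  by exists x.
have rf2 : recfun 2 (fun e => f (head 0 e)).
  exact: (recfun_subst rf (recenv_cons (recfun_var 0 2) (recenv_nil 2))).
by ps_auto.
Qed.

(** * Pullbacks of diagrams *)

(** Pulling a structure back along [h] acts in this way on its diagram
    ([pullback_comp]), the three cases being equality, inequality and the
    relations.  As [map h] keeps lengths, a single formula
    handles the relations of all arities. *)
Definition coord_pullback (h : nat -> nat) (S : set nat) : set nat :=
  [set z | exists s : seq nat,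
    [\/ z = (code s).*2.*2 /\ S (code (map h s)).*2.*2,
        z = (code s).*2.+1.*2 /\ S (code (map h s)).*2.+1.*2
      | exists i, z = (pair_code i (code s)).*2.+1 /\
          S (pair_code i (code (map h s))).*2.+1]].

Lemma coord_pullback_reducible h S :
  enum_reducible (coord_pullback h S) (join S (graph h)).
Proof.
(* [d] codes the image under [h] of the list coded by [c]; in the join [J],
   even numbers are queries to [S] and odd ones to [graph h]. *)
apply: (@enum_reducible_by (fun J z => exists c d : nat,
  [/\ size (decode d) == size (decode c)
    & forall i, i < size (decode c) ->
      J (pair_code (nth 0 (decode c) i) (nth 0 (decode d) i)).*2.+1] /\
  (z == c.*2.*2 /\ J d.*2.*2.*2 \/
   (z == c.*2.+1.*2 /\ J d.*2.+1.*2.*2 \/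
    exists i : nat,
      z == (pair_code i c).*2.+1 /\ J (pair_code i d).*2.+1.*2)))).
  by ps_auto.
move=> z; split.
  move=> [s sz]; exists (code s), (code (map h s)); split.
    rewrite !codeK size_map; split=> // i lt_i; apply/join_doubleS/graph_pair.
    by rewrite (nth_map 0).
  case: sz => [[-> Sz]|[-> Sz]|[i [-> Sz]]].
  - by left; split=> //; apply/join_double.
  - by right; left; split=> //; apply/join_double.
  - by right; right; exists i; split=> //; apply/join_double.
move=> [c [d [[/eqP size_d dh] dz]]]; exists (decode c).
have -> : code (map h (decode c)) = d.
  apply: (can_inj decodeK); rewrite codeK; apply: (@eq_from_nth _ 0).
    by rewrite size_map.
  move=> i; rewrite size_map => lt_i.
  by rewrite (nth_map 0)//; apply/graph_pair/join_doubleS/dh.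
rewrite decodeK.
case: dz => [[/eqP -> /join_double Sd]|[[/eqP -> /join_double Sd]|
              [i [/eqP -> /join_double Sd]]]].
- by apply: Or31.
- by apply: Or32.
- by apply: Or33; exists i.
Qed.

Lemma tuple_codesE n (X : set (n.-tuple nat)) s :
  tuple_codes X (code s) <-> exists2 t : n.-tuple nat, X t & tval t = s.
Proof.
split=> [[t Xt /(can_inj codeK) ts]|[t Xt <-]]; first by exists t.
by exists t.
Qed.

Lemma tuple_codes_code n (X : set (n.-tuple nat)) z :
  tuple_codes X z -> exists s, z = code s.
Proof. by case=> t _ <-; exists t. Qed.

Lemma bigjoin_pair X i x : bigjoin X (pair_code i x) <-> X i x.
Proof.
split=> [[j [y [Xjy /pair_code_inj[-> ->]]]]//|Xix].
by exists i, x.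
Qed.

Lemma pullback_rel_comp g h n (X : set (n.-tuple nat)) s :
  pullback_rel (g \o h) X (code s) <-> pullback_rel g X (code (map h s)).
Proof.
rewrite /pullback_rel; split=> /tuple_codesE[t /= Xt ts]; apply/tuple_codesE.
  exists (map_tuple h t) => /=; last by rewrite ts.
  suff -> : map_tuple g (map_tuple h t) = map_tuple (g \o h) t by [].
  by apply: val_inj; rewrite /= map_comp.
have size_s : size s == n by rewrite -(size_map h) -ts size_tuple.
exists (Tuple size_s) => //=.
suff -> : map_tuple (g \o h) (Tuple size_s) = map_tuple g t by [].
by apply: val_inj; rewrite /= ts map_comp.
Qed.

Lemma pullback_comp L (A : structure L) g h :
  pullback (g \o h) A = coord_pullback h (pullback g A).
Proof.
apply/seteqP; split=> z.
  case=> [[x [[y Xy <-]|[y Xy <-]] <-]|[y [i [x [Xx ->]]] <-]].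
  - have [s ys] := tuple_codes_code Xy; rewrite {}ys in Xy *.
    exists s; apply: Or31; split=> //; apply/join_double/join_double.
    exact: (proj1 (pullback_rel_comp _ _ _ _) Xy).
  - have [s ys] := tuple_codes_code Xy; rewrite {}ys in Xy *.
    exists s; apply: Or32; split=> //; apply/join_double/join_doubleS.
    exact: (proj1 (pullback_rel_comp _ _ _ _) Xy).
  - have [s ys] := tuple_codes_code Xx; rewrite {}ys in Xx *.
    exists s; apply: Or33; exists i; split=> //.
    apply/join_doubleS/bigjoin_pair.
    exact: (proj1 (pullback_rel_comp _ _ _ _) Xx).
case=> s [[-> /join_double/join_double H]|[-> /join_double/join_doubleS H]|].
- apply/join_double/join_double.
  exact: (proj2 (pullback_rel_comp _ _ _ _) H).
- apply/join_double/join_doubleS.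
  exact: (proj2 (pullback_rel_comp _ _ _ _) H).
move=> [i [-> /join_doubleS/bigjoin_pair H]].
apply/join_doubleS/bigjoin_pair.
exact: (proj2 (pullback_rel_comp _ _ _ _) H).
Qed.

(** Injectivity is what makes the equality and inequality components agree. *)
Lemma pos_diagram_pullback L (C D : structure L) u :
  Hom C D u -> pos_diagram C = pullback u D.
Proof.
move=> [/bij_inj u_inj CD]; rewrite /pos_diagram /pullback.
congr (join (join _ _) (bigjoin _)).
- congr tuple_codes; apply/funext => t; apply/propext.
  by rewrite /eq_rel /= !tnth_map; split=> [->|/u_inj].
- congr tuple_codes; apply/funext => t; apply/propext.
  rewrite /neq_rel /= !tnth_map; split=> ne E; apply: ne.
    exact: u_inj.
  by rewrite E.
- apply/funext => i; congr tuple_codes; apply/funext => t; apply/propext.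
  exact: CD.
Qed.

Lemma pullback_eq L (A : structure L) f x y :
  pullback f A (pair_code x y).*2.*2 <-> f x = f y.
Proof.
rewrite [pair_code x y]/(code [:: x; y]).
split=> [/join_double/join_double/tuple_codesE[t ft ts]|fxy].
  by move: ft; rewrite /eq_rel /= !tnth_map !(tnth_nth 0) ts.
apply/join_double/join_double; by exists [tuple x; y].
Qed.

Lemma pullback_neq L (A : structure L) f x y :
  pullback f A (pair_code x y).*2.+1.*2 <-> f x <> f y.
Proof.
rewrite [pair_code x y]/(code [:: x; y]).
split=> [/join_double/join_doubleS/tuple_codesE[t ft ts]|fxy].
  by move: ft; rewrite /neq_rel /= !tnth_map !(tnth_nth 0) ts.
apply/join_double/join_doubleS; by exists [tuple x; y].
Qed.

(** * Least representatives of an enumeration *)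

Section LeastRepresentatives.
Variable f : nat -> nat.

Definition first_occurrence x := f x \notin map f (iota 0 x).

Definition rank x := count first_occurrence (iota 0 x).

Lemma rankS x : rank x.+1 = rank x + first_occurrence x.
Proof. by rewrite /rank -addn1 iotaD count_cat /= addn0. Qed.

Lemma leq_rank x y : x <= y -> rank x <= rank y.
Proof.
by move=> le_xy; rewrite /rank -(subnKC le_xy) iotaD count_cat leq_addr.
Qed.

Lemma rank_inj x y : first_occurrence x -> first_occurrence y ->
  rank x = rank y -> x = y.
Proof.
have lt_rank a b : first_occurrence a -> a < b -> rank a < rank b.
  by move=> fa /leq_rank; apply: leq_trans; rewrite rankS fa addn1.
move=> fx fy E.
case: (ltngtP x y) => [/(lt_rank _ _ fx)|/(lt_rank _ _ fy)|//];
  by rewrite E ltnn.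
Qed.

Lemma first_occurrence_exists x :
  exists y, [/\ y <= x, f y = f x & first_occurrence y].
Proof.
have ex_y : exists y, f y == f x by exists x.
case: (ex_minnP ex_y) => y /eqP fy min_y; exists y.
split=> //; first exact: min_y.
apply/mapP => -[z]; rewrite mem_iota /= => lt_zy fyz.
by have := min_y z; rewrite -fyz fy eqxx leqNgt lt_zy => /(_ isT).
Qed.

Lemma first_occurrence_eq x y : first_occurrence x -> first_occurrence y ->
  f x = f y -> x = y.
Proof.
have notlt a b : first_occurrence b -> f a = f b -> ~~ (a < b).
  by move=> fb E; apply: contra fb => lt_ab; rewrite -E map_f// mem_iota.
move=> fx fy E; case: (ltngtP x y) => // lt_xy.
  by have := notlt x y fy E; rewrite lt_xy.
by have := notlt y x fx (esym E); rewrite lt_xy.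
Qed.

Hypothesis f_enum : enumeration f.

(** The values [0 .. n] are all taken below some [x], and the first occurrences
    below [x] take each of them. *)
Lemma rank_unbounded n : exists x, n < rank x.
Proof.
have [r fr] := choice f_enum.
have [x lt_rx] : exists x, forall m, m < n.+1 -> r m < x.
  exists (\max_(i < n.+1) r i).+1 => m lt_m.
  exact: (leq_bigmax (Ordinal lt_m)).
exists x.
have sub : {subset iota 0 n.+1 <=
    map f [seq y <- iota 0 x | first_occurrence y]}.
  move=> m; rewrite mem_iota /= add0n => lt_m.
  have [y [le_y fy first_y]] := first_occurrence_exists (r m).
  apply/mapP; exists y; last by rewrite fy fr.
  by rewrite mem_filter first_y mem_iota (leq_ltn_trans le_y (lt_rx m lt_m)).
have := uniq_leq_size (iota_uniq _ _) sub.
by rewrite size_iota size_map size_filter.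
Qed.

Lemma rank_surj n : exists x, first_occurrence x /\ rank x = n.
Proof.
case: (ex_minnP (rank_unbounded n)) => -[//|x] lt_n min_x; exists x.
have le_xn : rank x <= n.
  by rewrite leqNgt; apply/negP => /min_x; rewrite ltnn.
move: lt_n; rewrite rankS; case: first_occurrence => /=.
  by rewrite addn1 ltnS => le_nx; split=> //; apply/eqP; rewrite eqn_leq le_xn.
by rewrite addn0 ltnNge le_xn.
Qed.

End LeastRepresentatives.

Lemma first_occurrenceP f x :
  first_occurrence f x <-> forall y, y < x -> f x <> f y.
Proof.
split=> [fx y lt_yx E|ne]; last first.
  by apply/mapP => -[y]; rewrite mem_iota /= => /ne.
by case/mapP: fx; exists y; rewrite ?mem_iota.
Qed.

Lemma not_first_occurrenceP f x :
  ~~ first_occurrence f x <-> exists y, y < x /\ f x = f y.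
Proof.
rewrite negbK; split=> [/mapP[y]|[y [lt_yx ->]]].
  by rewrite mem_iota /= => lt_yx E; exists y.
by rewrite map_f ?mem_iota.
Qed.

(** Being a first occurrence is positive in the pulled back inequality, and
    failing to be one is positive in the pulled back equality; the list [c] of
    the ranks up to [x] certifies which alternative holds at each step. *)
Lemma rank_graph_reducible L (A : structure L) f h :
  (forall n x, h n = x <-> first_occurrence f x /\ rank f x = n) ->
  enum_reducible (graph h) (pullback f A).
Proof.
(* [Z] is queried at [.*2.+1.*2] for inequality, at [.*2.*2] for equality. *)
move=> hP; apply: (@enum_reducible_by (fun Z z => exists c x : nat,
  (z == pair_code (nth 0 (decode c) x) x /\ nth 0 (decode c) 0 == 0) /\
  ((forall j, j < x -> Z (pair_code x j).*2.+1.*2) /\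
   (forall i, i < x ->
     (forall j, j < i -> Z (pair_code i j).*2.+1.*2) /\
       nth 0 (decode c) i.+1 == (nth 0 (decode c) i).+1 \/
     (exists j : nat, j < i /\ Z (pair_code i j).*2.*2) /\
       nth 0 (decode c) i.+1 == nth 0 (decode c) i)))).
  by ps_auto.
have newP i : (forall j, j < i -> pullback f A (pair_code i j).*2.+1.*2) <->
    first_occurrence f i.
  by rewrite first_occurrenceP; split=> H j lt_j; apply/(pullback_neq A)/H.
have oldP i : (exists j, j < i /\ pullback f A (pair_code i j).*2.*2) <->
    ~~ first_occurrence f i.
  rewrite not_first_occurrenceP.
  by split=> -[j [lt_j ij]]; exists j; split=> //; apply/(pullback_eq A).
move=> z; split=> [[n [x [/hP[fx <-] ->]]]|].
  exists (code (mkseq (rank f) x.+1)), x; rewrite codeK.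
  have sE i : i <= x -> nth 0 (mkseq (rank f) x.+1) i = rank f i.
    by move=> le_i; rewrite nth_mkseq.
  rewrite !sE//; split=> //; split; first exact/newP.
  move=> i lt_i; rewrite !sE ?(ltnW lt_i)// rankS.
  case: (boolP (first_occurrence f i)) => [/newP fi|/oldP fi]; [left|right].
    by rewrite addn1.
  by rewrite addn0.
move=> [c [x [[/eqP -> /eqP c0] [/newP fx cS]]]].
exists (nth 0 (decode c) x), x; split=> //; apply/hP; split=> //.
elim: x cS {fx} => [//|i IH] cS; rewrite rankS IH; last first.
  by move=> j lt_j; apply: cS; exact: ltnW.
case: (cS i (leqnn _)) => -[].
  by move=> /newP -> /eqP ->; rewrite addn1.
by move=> /oldP/negPf -> /eqP ->; rewrite addn0.
Qed.

(** [h n] is the [n]-th first occurrence and [k x] the index of the fibre of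
    [x]. *)
Lemma transversal L (A : structure L) f : enumeration f ->
  exists h k : nat -> nat, [/\ bijective (f \o h), f \o h \o k = f,
    enum_reducible (graph h) (pullback f A) &
    enum_reducible (graph k) (pullback f A)].
Proof.
move=> f_enum; have [h hP] := choice (rank_surj f_enum).
have fh_surj x : exists n, f (h n) = f x.
  have [y [_ fy first_y]] := first_occurrence_exists f x.
  exists (rank f y); rewrite -fy; congr f.
  have [first_h rank_h] := hP (rank f y).
  exact: (rank_inj first_h first_y).
have [k kP] := choice fh_surj.
have fh_inj : injective (f \o h).
  move=> n m E; have [fn <-] := hP n; have [fm <-] := hP m.
  by rewrite (first_occurrence_eq fn fm E).
have rh : enum_reducible (graph h) (pullback f A).
  apply: rank_graph_reducible => n x; have [fn rn] := hP n.
  split=> [<-//|[fx rx]]; apply: (rank_inj fn fx); by rewrite rn.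
exists h, k; split=> //.
- have [r fr] := choice f_enum; exists (k \o r) => [n|y] /=; last by rewrite kP.
  by apply: fh_inj; rewrite /= kP fr.
- by apply/funext => x /=; rewrite kP.
apply: enum_reducible_trans (enum_reducible_join (enum_reducible_refl _) rh).
(* [k x = y] if and only if [f x = f w] for [w := h y]. *)
apply: (@enum_reducible_by (fun Z z => exists x y w : nat, z == pair_code x y /\
  (Z (pair_code x w).*2.*2.*2 /\ Z (pair_code y w).*2.+1))); first by ps_auto.
move=> z; split.
  move=> [x [y [<- ->]]]; exists x, (k x), (h (k x)); split=> //; split.
    by apply/join_double/pullback_eq; rewrite kP.
  by apply/join_doubleS/graph_pair.
move=> [x [y [w [/eqP -> [/join_double/pullback_eq E]]]]].
move=> /join_doubleS/graph_pair yw.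
by apply/graph_pair/fh_inj; rewrite /= kP yw.
Qed.

(** * Transfer of spectra *)

Definition interleave (s t : nat -> nat) n := if odd n then t n./2 else s n./2.

Lemma interleave_double s t n : interleave s t n.*2 = s n.
Proof. by rewrite /interleave odd_double doubleK. Qed.

Lemma interleave_doubleS s t n : interleave s t n.*2.+1 = t n.
Proof. by rewrite /interleave /= odd_double uphalf_double. Qed.

Lemma interleave_surj s t : enumeration s -> enumeration (interleave s t).
Proof.
move=> s_enum y; have [x <-] := s_enum y.
by exists x.*2; rewrite interleave_double.
Qed.

Lemma graph_interleave_reducible s t X :
  enum_reducible (graph s) X -> enum_reducible (graph t) X ->
  enum_reducible (graph (interleave s t)) X.
Proof.
move=> rs rt; apply: enum_reducible_trans (enum_reducible_join rs rt).
apply: (@enum_reducible_by (fun Z z => exists x y : nat,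
  z == pair_code x.*2 y /\ Z (pair_code x y).*2 \/
  z == pair_code x.*2.+1 y /\ Z (pair_code x y).*2.+1)); first by ps_auto.
move=> z; split.
  move=> [n [_ [<- ->]]]; exists n./2, (interleave s t n).
  have := odd_double_half n.
  case: (boolP (odd n)) => odd_n nE; [right|left]; split.
  - by apply/eqP; congr pair_code; rewrite -[LHS]nE.
  - by apply/join_doubleS/graph_pair; rewrite /interleave odd_n.
  - by apply/eqP; congr pair_code; rewrite -[LHS]nE.
  - by apply/join_double/graph_pair; rewrite /interleave (negPf odd_n).
move=> [x [y [[/eqP -> /join_double/graph_pair <-]|]]]; last first.
  move=> [/eqP -> /join_doubleS/graph_pair <-].
  by apply/graph_pair; rewrite interleave_doubleS.
by apply/graph_pair; rewrite interleave_double.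
Qed.

Lemma graph_reducible_interleavel s t :
  enum_reducible (graph s) (graph (interleave s t)).
Proof.
apply: (@enum_reducible_by (fun Z z => exists x y : nat,
  z == pair_code x y /\ Z (pair_code x.*2 y))); first by ps_auto.
move=> z; split=> [[x [y [xy ->]]]|[x [y [/eqP -> /graph_pair]]]].
  by exists x, y; split=> //; apply/graph_pair; rewrite interleave_double.
by rewrite interleave_double => ?; apply/graph_pair.
Qed.

Lemma graph_reducible_interleaver s t :
  enum_reducible (graph t) (graph (interleave s t)).
Proof.
apply: (@enum_reducible_by (fun Z z => exists x y : nat,
  z == pair_code x y /\ Z (pair_code x.*2.+1 y))); first by ps_auto.
move=> z; split=> [[x [y [xy ->]]]|[x [y [/eqP -> /graph_pair]]]].
  by exists x, y; split=> //; apply/graph_pair; rewrite interleave_doubleS.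
by rewrite interleave_doubleS => ?; apply/graph_pair.
Qed.

Lemma pullback_iso_reducible L (D B : structure L) phi k :
  Hom D B phi ->
  enum_reducible (pullback (phi \o k) B) (join (pos_diagram D) (graph k)).
Proof.
move=> Dphi; rewrite pullback_comp -(pos_diagram_pullback Dphi).
exact: coord_pullback_reducible.
Qed.

(** A diagram is recovered from that of an isomorphic copy and the isomorphism;
    in [eSp_subset] this leads back from [G (F C)] to [C]. *)
Lemma pos_diagram_iso_reducible L (C D : structure L) u :
  Hom C D u -> enum_reducible (pos_diagram C) (join (pos_diagram D) (graph u)).
Proof.
move=> CDu; rewrite (pos_diagram_pullback CDu).
exact: (@pullback_iso_reducible _ D D id u (Hom_id D)).
Qed.

(** The copy [C] is [A] renamed along the transversal, [k] the fibre index. *)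
Lemma pullback_canonical L (A : structure L) f : enumeration f ->
  exists (C : structure L) (k : nat -> nat), [/\ Iso A C,
    enum_reducible (pullback f A) (join (pos_diagram C) (graph k)) &
    enum_reducible (join (pos_diagram C) (graph k)) (pullback f A)].
Proof.
move=> f_enum; have [h [k [fh_bij fhk rh rk]]] := transversal A f_enum.
pose C : structure L := fun i t => A i (map_tuple (f \o h) t).
have CA : Hom C A (f \o h) by [].
exists C, k; split; first by exists (f \o h).
  by rewrite -[f in pullback f A]fhk; exact: pullback_iso_reducible.
apply: enum_reducible_join rk; rewrite (pos_diagram_pullback CA) pullback_comp.
apply: enum_reducible_trans (coord_pullback_reducible _ _) _.
exact: enum_reducible_join (enum_reducible_refl _) rh.
Qed.

(** Upward closure of the spectrum by total degrees: an enumeration need not be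
    injective, so the odd numbers are free to carry [t] as repetitions. *)
Lemma pullback_absorb L (B D : structure L) (t : nat -> nat) : Iso B D ->
  exists g : nat -> nat, [/\ enumeration g,
    enum_reducible (pullback g B) (join (pos_diagram D) (graph t)) &
    enum_reducible (join (pos_diagram D) (graph t)) (pullback g B)].
Proof.
move=> [phi DB]; pose s := interleave id t; exists (phi \o s).
have phi_bij : bijective phi by case: DB.
split.
- move=> y; case: phi_bij => psi _ phiK.
  have [x sx] : exists x, s x = psi y by apply: interleave_surj => z; exists z.
  by exists x; rewrite /= sx phiK.
- apply: enum_reducible_trans (pullback_iso_reducible s DB) _.
  apply: enum_reducible_join; first exact: enum_reducible_joinl.
  apply: graph_interleave_reducible; last exact: enum_reducible_joinr.
  by apply: enum_reducible_graph; exact: recfun_var 0 _.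
apply: enum_reducible_join.
  have -> : pos_diagram D = coord_pullback double (pullback (phi \o s) B).
    rewrite (pos_diagram_pullback DB) -pullback_comp; congr pullback.
    by apply/funext => n; rewrite /= /s interleave_double.
  apply: enum_reducible_trans (coord_pullback_reducible _ _) _.
  apply: enum_reducible_join (enum_reducible_refl _) _.
  by apply: enum_reducible_graph; rec_auto.
apply: (@enum_reducible_by (fun Z z => exists x y : nat,
  z == pair_code x y /\ Z (pair_code x.*2.+1 y.*2).*2.*2)); first by ps_auto.
(* The repetition [2 x + 1] of [t x] is equivalent to [2 y] exactly when
   [t x = y]. *)
have tP x y : pullback (phi \o s) B (pair_code x.*2.+1 y.*2).*2.*2 <-> t x = y.
  rewrite pullback_eq /= /s interleave_double interleave_doubleS.
  by split=> [/(bij_inj phi_bij)|->].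
move=> z; split=> [[x [y [/tP xy ->]]]|[x [y [/eqP -> /tP xy]]]].
  by exists x, y.
exact/graph_pair.
Qed.

(** The isomorphism [u] may carry information about [C] that [F C] lacks, so it
    joins [k] in the function that the pullback of [B] absorbs. *)
Lemma eSp_subset LA LB (A : structure LA) (B : structure LB)
    (F : structure LA -> structure LB) (G : structure LB -> structure LA) :
  (forall C, Iso A C -> Iso B (F C)) ->
  (forall C, Iso A C -> enum_reducible (pos_diagram (F C)) (pos_diagram C)) ->
  (forall D, Iso B D -> enum_reducible (pos_diagram (G D)) (pos_diagram D)) ->
  (forall C, Iso A C -> exists2 u, Hom C (G (F C)) u &
     enum_reducible (graph u) (pos_diagram C)) ->
  eSp A `<=` eSp B.
Proof.
move=> inF rF rG isoGF _ [f f_enum <-].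
have [C [k [AC fCk Ckf]]] := pullback_canonical A f_enum.
have [u CGF ru] := isoGF C AC; have BF := inF C AC.
have [g [g_enum gt tg]] := pullback_absorb (interleave u k) BF.
exists g => //; apply: enum_degree_eq.
  apply: enum_reducible_trans gt (enum_reducible_trans _ Ckf).
  apply: enum_reducible_join.
    exact: enum_reducible_trans (rF C AC) (enum_reducible_joinl _ _).
  apply: graph_interleave_reducible; last exact: enum_reducible_joinr.
  exact: enum_reducible_trans ru (enum_reducible_joinl _ _).
apply: enum_reducible_trans fCk (enum_reducible_trans _ tg).
have rt : enum_reducible (graph (interleave u k))
    (join (pos_diagram (F C)) (graph (interleave u k))).
  exact: enum_reducible_joinr.
apply: enum_reducible_join.
  apply: enum_reducible_trans (pos_diagram_iso_reducible CGF) _.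
  apply: enum_reducible_join.
    exact: enum_reducible_trans (rG _ BF) (enum_reducible_joinl _ _).
  exact: enum_reducible_trans (graph_reducible_interleavel u k) rt.
exact: enum_reducible_trans (graph_reducible_interleaver u k) rt.
Qed.

Theorem theorem18 (LA LB : language) (A : structure LA) (B : structure LB)
    (hAB : bi_transformable A B) : eSp A = eSp B.
Proof.
have diagram_reducible L L' (K : set (structure L)) (K' : set (structure L'))
    (F : functor K K') C : positive_enumerable F -> K C ->
    enum_reducible (pos_diagram (fobj F C)) (pos_diagram C).
  move=> [Psi [PsiS [cePsi _ PsiP]]] KC.
  by exists Psi => //; case: (PsiP C C KC KC).
case: hAB => F [G [posF posG [Lam [Lam' [ceLam ceLam' [isoA _] [isoB _] _]]]]].
apply/seteqP; split.
  apply: (@eSp_subset _ _ _ _ (fobj F) (fobj G)) => [C|C|D|C AC].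
  - exact: fobj_in.
  - exact: diagram_reducible.
  - exact: diagram_reducible.
  - by have [u Cu uE] := isoA C AC; exists u => //; exists Lam.
apply: (@eSp_subset _ _ _ _ (fobj G) (fobj F)) => [C|C|D|C AC].
- exact: fobj_in.
- exact: diagram_reducible.
- exact: diagram_reducible.
- by have [u Cu uE] := isoB C AC; exists u => //; exists Lam'.
Qed.
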